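(* Let $m>3$ be an integer and let $\mathfrak M$ be an anti-$m$-polypappian connected partial Steiner triple system with the points of degree $>1$. Then $$\mathrm{Aut}(\circledast^{m}\mathfrak M)=\{\,f\times\tau_u\colon f\in\mathrm{Aut}(\mathfrak M),\ u\in C_m\,\}.$$ Consequently, $\mathrm{Aut}(\circledast^{m}\mathfrak M)\cong\mathrm{Aut}(\mathfrak M)\oplus C_m$.
   Context: A partial Steiner triple system (PSTS) is a structure $\mathfrak M=\langle S,\mathcal L\rangle$ with point set $S$ and a family $\mathcal L$ of 3-element subsets of $S$ (lines) such that any two distinct points lie on at most one line. $C_m$ is the cyclic group of integers modulo $m$. For an integer $m\ge 3$, the $m$-weaved configuration $\circledast^{m}\mathfrak M$ has point set $S\times C_m$ and its lines are all the sets $\{(a,i),(b,i),(c,i+1)\}$ with $\{a,b,c\}\in\mathcal L$ (in any ordering of $a,b,c$) and $i\in C_m$; it is again a PSTS. Automorphisms are permutations of the points preserving the family of lines. The degree of a point is the number of lines through it. Connected means that any two points can be joined by a sequence of successively collinear points. $\tau_u$ is the translation $i\mapsto i+u$ of $C_m$, and $(f\times\tau_u)(a,i)=(f(a),i+u)$. $\oplus$ denotes the direct product of groups. For an integer $k\ge 3$ and a permutation $\gamma$ of $C_3$, the configuration $\Pi^k_\gamma$ has point set $C_3\times C_k$ (with $C_k=\{0,\ldots,k-1\}$) and lines: $\{(a,i),(b,i),(c,i+1)\}$ for all $a,b,c$ with $\{a,b,c\}=C_3$ and $i=0,\ldots,k-2$, together with $\{(a,k-1),(b,k-1),(\gamma(c),0)\}$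 for all $a,b,c$ with $\{a,b,c\}=C_3$. Let $\tau_1(a)=a+1$ and $\sigma_0(a)=-a$ on $C_3$. $\mathfrak M$ is called anti-$m$-polypappian if it contains (as a subconfiguration) none of the following: $\Pi^{m_0}_{\mathrm{id}}$ with $m_0\mid m$; $\Pi^{m_0}_{\sigma_0}$ with $2m_0\mid m$; $\Pi^{m_0}_{\tau_1}$ with $3m_0\mid m$ (where $m_0\ge 3$). *)

(* Defs.v *)
From HB Require Import structures.
From mathcomp Require Import all_boot all_algebra all_fingroup.
From mathcomp Require Import boolp classical_sets functions cardinality.

Set Implicit Arguments.
Unset Strict Implicit.
Unset Printing Implicit Defensive.

Import GRing.Theory.

Local Open Scope classical_set_scope.
Local Open Scope card_scope.
Local Open Scope ring_scope.

(* A configuration is given by its point type [S] (possibly infinite) and its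
   set of lines [L : set (set S)]; lines are sets of points. *)

Section Configurations.
Variables (S : Type) (L : set (set S)).

Definition psts : Prop :=
  (forall l, L l -> l #= `I_3) /\
  (forall l1 l2 x y, L l1 -> L l2 -> x <> y ->
     l1 x -> l1 y -> l2 x -> l2 y -> l1 = l2).

Definition pencil (x : S) : set (set S) := [set l | L l /\ l x].

Definition degree_gt1 (x : S) : Prop := `I_2 #<= pencil x.

Definition collinear (x y : S) : Prop := exists l, [/\ L l, l x & l y].

Definition config_connected : Prop :=
  forall x y : S, exists s : seq S,
    path (fun u v => `[< collinear u v >]) x s /\ last x s = y.

Definition config_aut : set (S -> S) :=
  [set f | bijective f /\ forall l, L (f @` l) <-> L l].

End Configurations.

(* Subconfigurations need not be induced: [L] may have further lines among the
   points of the embedded copy. *)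
Definition contains_config (S : Type) (L : set (set S))
    (P : Type) (K : set (set P)) : Prop :=
  exists phi : P -> S, injective phi /\ forall l, K l -> L (phi @` l).

(* When the members of [L] have three elements, [a], [b], [c] below are
   necessarily distinct. *)
Definition weave (m : nat) (S : Type) (L : set (set S)) :
    set (set (S * 'Z_m)) :=
  [set l | exists (a b c : S) (i : 'Z_m), L [set a; b; c] /\
     l = [set (a, i); (b, i); (c, i + 1)]].

(* In 'Z_k the index i + 1 wraps around to 0 for i = k - 1; the permutation is
   applied exactly on these lines. *)
Definition polypappus (k : nat) (gamma : {perm 'Z_3}) :
    set (set ('Z_3 * 'Z_k)) :=
  [set l | exists (a b c : 'Z_3) (i : 'Z_k), [set a; b; c] = [set: 'Z_3] /\
     l = [set (a, i); (b, i);
              (if (i : nat) == k.-1 then gamma c else c, i + 1)]].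

Definition tau1 : {perm 'Z_3} := perm (@addIr 'Z_3 1).
Definition sigma0 : {perm 'Z_3} := perm (@oppr_inj 'Z_3).

Definition anti_polypappian (m : nat) (S : Type) (L : set (set S)) : Prop :=
  forall m0 : nat, (3 <= m0)%N ->
    [/\ (m0 %| m)%N -> ~ contains_config L (@polypappus m0 1%g),
        (2 * m0 %| m)%N -> ~ contains_config L (@polypappus m0 sigma0) &
        (3 * m0 %| m)%N -> ~ contains_config L (@polypappus m0 tau1)].

Definition prod_tau (m : nat) (S : Type) (f : S -> S) (u : 'Z_m) :
    S * 'Z_m -> S * 'Z_m :=
  fun p => (f p.1, p.2 + u).

Record autGroup (S : Type) (L : set (set S)) := AutGroup {
  autGroup_fun :> S -> S;
  autGroupP : config_aut L autGroup_fun
}.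

Section AutGroup.
Variables (S : Type) (L : set (set S)).
Implicit Types f g : autGroup L.

Lemma autGroup_ext f g : f =1 g -> f = g.
Proof.
case: f g => [f fP] [g gP] /= /funext efg; subst g.
by congr AutGroup; apply: Prop_irrelevance.
Qed.

Lemma aut_id : config_aut L id.
Proof. by split=> [|l]; [exists id | rewrite image_id]. Qed.

Lemma aut_comp f g : config_aut L (f \o g).
Proof.
have [[bf fP] [bg gP]] := (autGroupP f, autGroupP g).
split; first exact: bij_comp.
by move=> l; rewrite -image_comp; split; [move=> /fP /gP | move=> /gP /fP].
Qed.

Lemma autGroup_invP f : exists g : S -> S, cancel f g /\ cancel g f.
Proof. by have [[g fK gK] _] := autGroupP f; exists g. Qed.

Definition autGroup_inv_fun f : S -> S := projT1 (cid (autGroup_invP f)).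

Lemma autGroup_funK f : cancel f (autGroup_inv_fun f).
Proof. by rewrite /autGroup_inv_fun; case: cid => g []. Qed.

Lemma autGroup_inv_funK f : cancel (autGroup_inv_fun f) f.
Proof. by rewrite /autGroup_inv_fun; case: cid => g []. Qed.

Lemma aut_inv f : config_aut L (autGroup_inv_fun f).
Proof.
have [fK gK] := (autGroup_funK f, autGroup_inv_funK f).
split; first by exists f.
move=> l; have [_ /(_ (autGroup_inv_fun f @` l))] := autGroupP f.
by rewrite image_comp (_ : f \o _ = id) ?image_id; [case | apply/funext].
Qed.

Definition autGroup_one : autGroup L := AutGroup aut_id.
Definition autGroup_mul f g : autGroup L := AutGroup (aut_comp f g).
Definition autGroup_inv f : autGroup L := AutGroup (aut_inv f).

Lemma autGroup_mulA : associative autGroup_mul.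
Proof. by move=> f g h; apply: autGroup_ext. Qed.
Lemma autGroup_mul1 : left_id autGroup_one autGroup_mul.
Proof. by move=> f; apply: autGroup_ext. Qed.
Lemma autGroup_mulr1 : right_id autGroup_one autGroup_mul.
Proof. by move=> f; apply: autGroup_ext. Qed.
Lemma autGroup_mulV : left_inverse autGroup_one autGroup_inv autGroup_mul.
Proof. by move=> f; apply: autGroup_ext => x; apply: autGroup_funK. Qed.
Lemma autGroup_mulrV : right_inverse autGroup_one autGroup_inv autGroup_mul.
Proof. by move=> f; apply: autGroup_ext => x; apply: autGroup_inv_funK. Qed.

HB.instance Definition _ := gen_eqMixin (autGroup L).
HB.instance Definition _ := gen_choiceMixin (autGroup L).
HB.instance Definition _ := isGroup.Build (autGroup L)
  autGroup_mulA autGroup_mul1 autGroup_mulr1 autGroup_mulV autGroup_mulrV.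

End AutGroup.

(* The group law [*%g] on 'Z_m is addition of residues, so ['Z_m] as a
   [groupType] is the cyclic group C_m, and [G * H] carries the componentwise
   group structure of the direct product. *)
Definition isomorphic_groups (G H : groupType) : Prop :=
  exists phi : {multiplicative G -> H}, bijective phi.

(* Main.v *)
(* Let F be an automorphism of the weaving. On the points over a line {a, b, c},
   the levels of F (a, j), F (b, j), F (c, j) either are all equal to s + j or do
   not depend on j; by connectedness the same alternative holds for all points.
   - If the levels are constant, so are those of the inverse of F, hence the first
     coordinate of F (x, j) determines j. Then the images of the points over one
     line project injectively onto a copy of Pi^m_id in M.
   - Otherwise F (x, j) = (f j x, j + s). The permutations (f i)^-1 \o f j are
     "slides" h: if {a, b, c} is a line, so is {a, h b, h^-1 c}. Slides commute,
     act freely, and never map a point to a collinear one. Hence, for a line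
     {a, b, c}, the sets f j {a, b, c} are pairwise equal or disjoint, and unless
     f is constant they form a copy of Pi^k_id in M, k being the period of f. *)
Require Import Defs.
From HB Require Import structures.
From mathcomp Require Import all_boot all_algebra all_fingroup.
From mathcomp Require Import boolp classical_sets functions cardinality.

Set Implicit Arguments.
Unset Strict Implicit.
Unset Printing Implicit Defensive.

Import GRing.Theory.

Local Open Scope classical_set_scope.

(** * Three-element sets *)

Lemma set3_swap (T : Type) (x y z : T) : [set x; y; z] = [set y; x; z].
Proof. by rewrite (setUC [set x]). Qed.

Lemma set3_rot (T : Type) (x y z : T) : [set x; y; z] = [set y; z; x].
Proof. by rewrite -setUA setUC. Qed.

Lemma image_set3 (T U : Type) (f : T -> U) (x y z : T) :
  f @` [set x; y; z] = [set f x; f y; f z].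
Proof. by rewrite !image_setU !image_set1. Qed.

Lemma card_set3_neq (T : Type) (x y z : T) :
  ([set x; y; z] #= `I_3)%card -> x <> y.
Proof.
move=> c3 exy; have : (`I_3 #<= `I_2)%card.
  apply: (@card_le_trans _ _ _ [set x; y; z]).
    by move: c3; rewrite card_eq_le => /andP[].
  have -> : [set x; y; z] = (fun n : nat => if n == 0 then y else z) @` `I_2.
    apply/seteqP; split=> t /=.
      by move=> [[->|->]|->]; [exists 0|exists 0|exists 1].
    by move=> [[|[|//]] _ <-]; [left; right|right].
  exact: card_image_le.
by rewrite card_le_II.
Qed.

Lemma card3_set3 (T : Type) (l : set T) :
  (l #= `I_3)%card -> exists x y z, l = [set x; y; z].
Proof.
case/eq_cardSP=> x lx /eq_cardSP[y ly /eq_cardSP[z lz]].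
rewrite II0 card_eq0 => /eqP l0.
exists x, y, z.
rewrite -(setD1K lx) -setUA; congr setU.
rewrite -(setD1K ly); congr setU.
by rewrite -(setD1K lz) l0 setU0.
Qed.

(** A transposition and a 3-cycle generate all rearrangements, and a triple [p, q, r] with a
    repetition would miss one of [x, y, z]. *)
Lemma set3_perm (T : Type) (P : T -> T -> T -> Prop) (x y z p q r : T) :
  (forall a b c, P a b c -> P b a c) -> (forall a b c, P a b c -> P b c a) ->
  x <> y -> y <> z -> z <> x ->
  [set p; q; r] = [set x; y; z] -> P x y z -> P p q r.
Proof.
move=> swap rot nxy nyz nzx /seteqP[sub sup] Pxyz.
have /= := (sup x (or_introl (or_introl erefl)),
  sup y (or_introl (or_intror erefl)), sup z (or_intror erefl)).
have := sub r (or_intror erefl); have := sub q (or_introl (or_intror erefl)).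
have := sub p (or_introl (or_introl erefl)).
by move=> /= [[]|] -> [[]|] -> [[]|] -> [[h1 h2] h3];
  (solve [auto] || (exfalso; intuition congruence)).
Qed.

(** * Lines as ordered triples, in a configuration and in its weaving *)

Section Triples.
Variables (S : Type) (L : set (set S)).

Definition triple (a b c : S) : Prop := L [set a; b; c].

Lemma triple_swap a b c : triple a b c -> triple b a c.
Proof. by rewrite /triple set3_swap. Qed.

Lemma triple_rot a b c : triple a b c -> triple b c a.
Proof. by rewrite /triple (set3_rot a). Qed.

Lemma triple_swapr a b c : triple a b c -> triple a c b.
Proof. by move=> /triple_swap/triple_rot. Qed.

Hypothesis psts_L : psts L.

Lemma triple_neq a b c : triple a b c -> a <> b.
Proof. by move=> /psts_L.1; exact: card_set3_neq. Qed.

(** Both triples are the line through [a] and [b], whose only further point is [c]. *)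
Lemma triple_det a b c d : triple a b c -> triple a b d -> c = d.
Proof.
move=> Tc Td; have nab := triple_neq Tc.
have nbc := triple_neq (triple_rot Tc).
have nca := triple_neq (triple_rot (triple_rot Tc)).
have e : [set a; b; c] = [set a; b; d].
  by apply: (psts_L.2 _ _ a b) => //=;
    [left; left|left; right|left; left|left; right].
have : [set a; b; d] c by rewrite -e; right.
by move=> /= [[]|] e'; [case: nca|case: nbc|].
Qed.

Lemma line_triple l : L l -> exists a b c, l = [set a; b; c] /\ triple a b c.
Proof.
move=> Ll; have [a [b [c e]]] := card3_set3 (psts_L.1 _ Ll).
by exists a, b, c; split; rewrite // /triple -e.
Qed.

Lemma point_triple x : degree_gt1 L x -> exists b c, triple x b c.
Proof.
move=> dx; have [l [Ll lx]] : pencil L x !=set0.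
  apply/set0P/eqP => p0; move: dx.
  by rewrite /degree_gt1 p0 card_le0 => /eqP/seteqP[/(_ 0 isT)].
have [a [b [c [e Tabc]]]] := line_triple Ll.
move: lx; rewrite e => -[[]|] ->; first by exists b, c.
  by exists c, a; exact: triple_rot.
by exists a, b; do 2!apply: triple_rot.
Qed.

Lemma connected_triple_ind (P : S -> Prop) :
  config_connected L ->
  (forall a b c, triple a b c -> P a -> P b) -> forall x y, P x -> P y.
Proof.
move=> connL step x y Px; have [s [+ <-]] := connL x y.
elim: s x Px => //= z s IHs x Px /andP[/asboolP[l [Ll lx lz]] /IHs]; apply.
have [a [b [c [e Tabc]]]] := line_triple Ll.
have Tbca := triple_rot Tabc; have Tcab := triple_rot Tbca.
move: lx lz Px; rewrite e.
move=> [[]|] -> [[]|] -> // Pu; apply: step Pu;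
  first [eassumption | apply: triple_swap; eassumption].
Qed.

(** The disjuncts say which point of the line is raised by one level: the third, the first or the
    second. *)
Definition weave_levels (m : nat) (i j k : 'Z_m) : Prop :=
  [\/ i = j /\ k = i + 1, j = k /\ i = j + 1 | k = i /\ j = k + 1]%R.

Lemma weave_tripleP (m : nat) (p q r : S * 'Z_m) :
  @weave m S L [set p; q; r] <->
  triple p.1 q.1 r.1 /\ weave_levels p.2 q.2 r.2.
Proof.
split=> [[a [b [c [i [Tabc e]]]]]|].
  have nab := triple_neq Tabc.
  have nbc := triple_neq (triple_rot Tabc).
  have nca := triple_neq (triple_rot (triple_rot Tabc)).
  pose P u v w := triple u.1 v.1 w.1 /\ @weave_levels m u.2 v.2 w.2.
  apply: (set3_perm (P := P) _ _ _ _ _ e); rewrite /P /weave_levels.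
  - move=> u v w [/triple_swap ? h]; split=> //.
    by case: h => -[? ->]; [apply: Or31|apply: Or33|apply: Or32];
      split; congruence.
  - move=> u v w [/triple_rot ? h]; split=> //.
    by case: h => -[? ->]; [apply: Or33|apply: Or31|apply: Or32].
  - by case.
  - by case.
  - by case.
  - by split=> //; apply: Or31.
case: p q r => [a i] [b j] [c k] /= [Tabc] [[<- ->]|[<- ->]|[<- ->]].
- by exists a, b, c, i.
- by exists b, c, a, j; split; [exact: triple_rot|rewrite set3_rot].
- exists c, a, b, k; split; last by rewrite -set3_rot.
  by do 2!apply: triple_rot.
Qed.

End Triples.

(** * Copies of Pi^k_id built from one line *)

Section Embedding.
Variables (S : Type) (L : set (set S)).
Hypothesis psts_L : psts L.

Lemma contains_polypappus (k : nat) (u : 'Z_k -> S -> S) (x y z : S) :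
  triple L x y z ->
  (forall i a b c, triple L a b c ->
     triple L (u i a) (u i b) (u (i + 1)%R c)) ->
  (forall i j a b, [set x; y; z] a -> [set x; y; z] b ->
     u i a = u j b -> i = j /\ a = b) ->
  contains_config L (@polypappus k 1%g).
Proof.
move=> Txyz uT u_inj.
pose pt (i : 'Z_3) :=
  if (i : nat) == 0 then x else if (i : nat) == 1 then y else z.
have ptT : pt @` [set: 'Z_3] = [set x; y; z].
  apply/seteqP; split=> [_ [[[|[|[|//]]] ?] _ <-]|t]; rewrite /pt /=.
  - by left; left.
  - by left; right.
  - by right.
  - by move=> [[]|] ->; [exists 0%R|exists 1%R|exists 2%:R%R].
have nxy := triple_neq psts_L Txyz.
have nyz := triple_neq psts_L (triple_rot Txyz).
have nzx := triple_neq psts_L (triple_rot (triple_rot Txyz)).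
have pt_in i : [set x; y; z] (pt i) by rewrite -ptT; exists i.
exists (fun p => u p.2 (pt p.1)); split.
  move=> [a i] [b j] /= /u_inj[] // -> e; congr pair; apply/val_inj.
  by move: e; case: a => [[|[|[|//]]] ?]; case: b => [[|[|[|//]]] ?];
    rewrite /pt //=; move/esym.
(* For the identity permutation both branches of the conditional agree, so the wrap-around lines
   need no separate treatment. *)
move=> _ [a [b [c [i [abc ->]]]]]; rewrite image_set3 /= perm1 if_same.
by apply: uT; rewrite /triple -image_set3 abc ptT.
Qed.

End Embedding.

(** * Slides: commutation and free action *)

Section Slides.
Variables (S : Type) (L : set (set S)).
Hypotheses (psts_L : psts L) (connL : config_connected L).
Hypothesis on_triple : forall x, exists y z, triple L x y z.
Local Notation T := (triple L).

(** The inverse [h'] is carried explicitly, so that inverting a slide just exchanges the two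
    maps. *)
Definition slide (h h' : S -> S) : Prop :=
  [/\ cancel h h', cancel h' h & forall a b c, T a b c -> T a (h b) (h' c)].

Lemma slide_sym h h' : slide h h' -> slide h' h.
Proof.
case=> hK h'K hT; split=> // a b c Tabc.
exact: (triple_swapr (hT _ _ _ (triple_swapr Tabc))).
Qed.

(** For a line [{b, x, y}], both [h (k b)] and [k (h b)] are the third point on the line through
    [h' x] and [k' y]. *)
Lemma slide_comm h h' k k' : slide h h' -> slide k k' -> h \o k =1 k \o h.
Proof.
move=> [_ _ hT] [_ _ kT] b; have [x [y Tbxy]] := on_triple b.
have Tybx := triple_rot (triple_rot Tbxy).
have T1 := kT _ _ _ (triple_swapr (triple_rot (triple_rot (hT _ _ _ Tybx)))).
have T2 := kT _ _ _ (triple_swap Tbxy).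
have T3 := hT _ _ _ (triple_swapr (triple_rot (triple_rot T2))).
apply: (triple_det psts_L (triple_rot (triple_rot T3))).
exact: (triple_swapr T1).
Qed.

Lemma slide_comp h h' k k' :
  slide h h' -> slide k k' -> slide (k \o h) (h' \o k').
Proof.
move=> sh sk; have [hK h'K hT] := sh; have [kK k'K kT] := sk.
split; [exact: can_comp|exact: can_comp|move=> a b c Tabc].
(* Sliding twice moves [c] by [k' \o h']; the inverse of [k \o h] is [h' \o k'], and these agree by
   commutation. *)
by rewrite (slide_comm (slide_sym sh) (slide_sym sk)); apply/kT/hT.
Qed.

(** If [h] fixes [a] on a line [{a, b, c}], then [{c, a, h' b}] is the same line, so [b] is fixed
    too; connectedness spreads this. *)
Lemma slide_fix h h' x y : slide h h' -> h x = x -> h y = y.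
Proof.
case=> _ h'K hT.
apply: (connected_triple_ind (P := fun z => h z = z) psts_L connL).
move=> a b c Tabc ha; have Tcab := triple_rot (triple_rot Tabc).
have := hT _ _ _ Tcab; rewrite ha => Tcah'b.
by rewrite {1}(triple_det psts_L Tcab Tcah'b) h'K.
Qed.

Lemma slide_neq h h' a b c : slide h h' -> T a b c -> h a <> b.
Proof.
case=> _ _ hT Tabc e.
exact: (triple_neq psts_L (hT _ _ _ (triple_swap Tabc)) (esym e)).
Qed.

End Slides.

(** * Level-shifting automorphisms: the period of [f] *)

Lemma val_Zp_succ (k : nat) (i : 'Z_k) :
  (1 < k)%N -> (i + 1 : 'Z_k)%R = i.+1 %% k :> nat.
Proof.
by case: k i => [|[|k]] // i _; rewrite /= [(1 %% _)%N]modn_small // addn1.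
Qed.

Section Rising.
Local Open Scope ring_scope.
Variables (S : Type) (L : set (set S)) (m : nat) (f g : 'Z_m -> S -> S).
Hypotheses (psts_L : psts L) (connL : config_connected L).
Hypothesis on_triple : forall x, exists y z, triple L x y z.
Hypothesis m_gt1 : (1 < m)%N.
Local Notation T := (triple L).
Hypothesis fT : forall j a b c, T a b c -> T (f j a) (f j b) (f (j + 1) c).
Hypothesis gT : forall j a b c, T a b c -> T (g j a) (g j b) (g (j + 1) c).
Hypothesis fK : forall j, cancel (f j) (g j).
Hypothesis gK : forall j, cancel (g j) (f j).

(** Apply [f] to the line with [b] as the raised point, then [g] with the image of [c] as the raised
    point. *)
Lemma slide_succ j : slide L (g j \o f (j + 1)) (g (j + 1) \o f j).
Proof.
split=> [x|x|a b c Tabc] /=; rewrite ?gK ?fK //.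
by have := gT j (triple_swapr (fT j (triple_swapr Tabc))); rewrite fK.
Qed.

Lemma slide_add i n : slide L (g i \o f (i + n%:R)) (g (i + n%:R) \o f i).
Proof.
elim: n => [|n IHn].
  rewrite addr0 (_ : g i \o f i = id); last by apply/funext => x /=; rewrite fK.
  by split.
have := slide_comp psts_L on_triple (slide_succ (i + n%:R)) IHn.
(* The product telescopes: the inner [f (i + n%:R)] cancels against its inverse. *)
by rewrite -addrA -natr1; congr slide; apply/funext => x /=; rewrite gK.
Qed.

Lemma slide_levels i j : slide L (g i \o f j) (g j \o f i).
Proof.
by have := slide_add i (j - i)%R; rewrite natr_Zp addrC subrK.
Qed.

(* Writing f (j + 1) = f j \o e, this reads e' = e^-2 for the next quotient e'. *)
Lemma level_quotient j x :
  g (j + 1) (f (j + 1 + 1) x) = g (j + 1) (f j (g (j + 1) (f j x))).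
Proof.
have [y [z Txyz]] := on_triple x; have [_ _ eT] := slide_succ j.
have Tyzx := triple_rot Txyz.
have T1 := eT _ _ _ (triple_swap (eT _ _ _ (triple_swap Tyzx))).
exact: (triple_det psts_L (gT j (fT (j + 1) Tyzx)) T1).
Qed.

(** [f (j + 1) x] is the third point of the line through the [f j]-images of the other two points of
    a line on [x], so each level determines the next. *)
Lemma level_succ i j : f i = f j -> f (i + 1) = f (j + 1).
Proof.
move=> fij; apply/funext => x; have [y [z Txyz]] := on_triple x.
have := fT j (triple_rot Txyz); have := fT i (triple_rot Txyz).
by rewrite fij; exact: triple_det.
Qed.

Lemma level_add i j n : f i = f j -> f (i + n%:R) = f (j + n%:R).
Proof.
move=> fij; elim: n => [|n IHn]; first by rewrite !addr0.
by rewrite -natr1 !addrA; exact: level_succ.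
Qed.

Lemma rising_constant (x0 : S) :
  (forall k, (2 < k)%N -> (k %| m)%N ->
     ~ contains_config L (@polypappus k 1%g)) ->
  forall j, f j = f 0.
Proof.
move=> no_pappus.
(* [k] is the least positive period of [f]; it exists because [m] is itself a period. *)
have [k [k_gt0 fk kmin]] : exists k, [/\ (0 < k)%N, f k%:R = f 0 &
    forall n, (0 < n)%N -> f n%:R = f 0 -> (k <= n)%N].
  have ex : exists k, (0 < k)%N && `[< f k%:R = f 0 >].
    exists m; rewrite (ltn_trans _ m_gt1) //; apply/asboolP; congr f.
    by apply/val_inj; rewrite /= val_Zp_nat // modnn.
  case: (ex_minnP ex) => k /andP[k_gt0 /asboolP fk] kmin.
  by exists k; split=> // n n_gt0 fn; apply: kmin; rewrite n_gt0; apply/asboolP.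
have fD n : f (k + n)%:R = f n%:R.
  by rewrite natrD (level_add n fk) add0r.
have fmod n : f n%:R = f (n %% k)%:R.
  rewrite {1}(divn_eq n k).
  elim: (n %/ k)%N => [|q IHq]; first by rewrite mul0n.
  by rewrite mulSn -addnA fD.
have f_per n : (n < k)%N -> f n%:R = f 0 -> n = 0%N.
  move=> lt_nk fn; apply/eqP; rewrite -leqn0 leqNgt; apply/negP => n_gt0.
  by have := kmin n n_gt0 fn; rewrite leqNgt lt_nk.
have k_dvd_m : (k %| m)%N.
  apply/eqP/f_per; first by rewrite ltn_pmod.
  by rewrite -fmod; congr f; apply/val_inj; rewrite /= val_Zp_nat // modnn.
have f_inj i j : (i <= j)%N -> (j < k)%N -> f i%:R = f j%:R -> i = j.
  move=> le_ij lt_jk fij; have le_jk := ltnW lt_jk.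
  apply/eqP; rewrite eqn_leq le_ij -subn_eq0; apply/eqP.
  apply: f_per; first exact: leq_ltn_trans (leq_subr _ _) lt_jk.
  (* Periods propagate only upwards, so instead of subtracting [i] the equality is shifted by
     [k - i], which gives [f 0 = f (j - i)%:R]. *)
  have := level_add (k - i) fij; rewrite -!natrD subnKC ?(leq_trans le_ij) //.
  by rewrite addnBCA ?(leq_trans le_ij) // fD fk => ->.
have [k_gt2|k_le2] := ltnP 2 k; last first.
  suff f1 : f 1 = f 0.
    move=> j; rewrite -(natr_Zp j); elim: (j : nat) => // n IHn.
    by rewrite -natr1 (level_succ IHn) add0r.
  clear kmin fD fmod f_per k_dvd_m f_inj.
  case: k k_gt0 k_le2 fk => [|[|[|//]]] // _ _ fk.
  (* Period 2 is too short for a Pi^k; here [f 2 = f 0] reduces the quotient relation to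
     [x = g 1 (f 0 x)]. *)
  apply/funext => x; have := level_quotient 0 x.
  rewrite add0r (_ : 1 + 1 = 2%:R) // fk.
  move=> /(can_inj (gK _))/(can_inj (fK _)) {1}->.
  by rewrite gK.
case: (no_pappus k k_gt2 k_dvd_m).
have [y [z Txyz]] := on_triple x0.
apply: (contains_polypappus (u := fun i : 'Z_k => f (i : nat)%:R) psts_L Txyz).
  move=> i a b c /(fT (i : nat)%:R).
  by rewrite val_Zp_succ ?(ltnW k_gt2) // -fmod -natr1.
move=> i j a b Ta Tb fab.
(* The slide [g j \o f i] sends [a] to [b]. Since [a] and [b] lie on one line they must coincide; a
   slide with a fixed point is the identity, whence [f i = f j]. *)
have sij := slide_levels (j : nat)%:R (i : nat)%:R.
have gf : (g (j : nat)%:R \o f (i : nat)%:R) a = b by rewrite /= fab fK.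
have eab : a = b.
  have Tyzx := triple_rot Txyz; have Tzxy := triple_rot Tyzx.
  move: Ta Tb fab gf => [[]|]-> [[]|]-> // _ gf; exfalso; move: gf;
    apply: (slide_neq psts_L sij);
    first [eassumption | apply: triple_swap; eassumption].
split=> //; apply/val_inj => /=.
have fij : f (i : nat)%:R = f (j : nat)%:R.
  rewrite eab in gf; apply/funext => x.
  rewrite -[LHS](gK (j : nat)%:R); congr (f _ _).
  exact: (slide_fix psts_L connL x sij gf).
have lt_ord (n : 'Z_k) : (n < k)%N.
  by rewrite -[X in (_ < X)%N]Zp_cast ?(ltnW k_gt2).
case/orP: (leq_total i j) => le; first exact: f_inj.
by apply/esym/f_inj.
Qed.

End Rising.

(** * How an automorphism of the weaving acts on levels *)

Section Levels.
Local Open Scope ring_scope.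
Variable m : nat.
Hypothesis m_gt3 : (3 < m)%N.

(** For [m > 3] the residues 1, 2 and 3 are nonzero, which excludes the unwanted level patterns. *)
Lemma Zp_add_neq n (x : 'Z_m) : (0 < n < 4)%N -> x + n%:R <> x.
Proof.
case/andP=> n_gt0 lt_n4; rewrite -[RHS]addr0 => /addrI/(congr1 val) /=.
rewrite val_Zp_nat ?modn_small ?(leq_trans lt_n4) //.
  by move=> n0; rewrite n0 in n_gt0.
exact: ltn_trans m_gt3.
Qed.

(** After elimination of the level equations, a branch is closed when an offset 1, 2 or 3 would
    vanish or when one of the two alternatives can be read off. *)
Local Ltac cyclic_cases n1 n2 n3 :=
  repeat match goal with
  | E : ?x + 1 = ?y + 1 |- _ => apply addIr in E
  | E : ?x = ?x |- _ => clear E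
  | E : ?x = ?y |- _ => first [subst x | subst y]
  end;
  try match goal with
  | E : ?x + 1 = ?x |- _ => case: (n1 _ E)
  | E : ?x = ?x + 1 |- _ => case: (n1 _ (esym E))
  | E : ?x + 1 + 1 = ?x |- _ => case: (n2 _ E)
  | E : ?x = ?x + 1 + 1 |- _ => case: (n2 _ (esym E))
  | E : ?x + 1 + 1 + 1 = ?x |- _ => case: (n3 _ E)
  | E : ?x = ?x + 1 + 1 + 1 |- _ => case: (n3 _ (esym E))
  end;
  try solve [by left | by right; split=> //; first
    [exact: Or31 (conj erefl erefl) | exact: Or32 (conj erefl erefl)
    | exact: Or33 (conj erefl erefl)]].

(* Three points of a line have either equal levels, all of which increase by 1
   at the next step, or levels t, t, t + 1 in some order, which are stationary;
   levels t, t + 1, t + 1 would be followed by t + 2, t, t, but the levels of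
   collinear points differ by at most 1. *)
Lemma levels_step (a b c a1 b1 c1 a2 b2 c2 : 'Z_m) :
  weave_levels a b c1 -> weave_levels b c a1 -> weave_levels c a b1 ->
  weave_levels a1 b1 c2 -> weave_levels b1 c1 a2 -> weave_levels c1 a1 b2 ->
  [/\ a = b, b = c, a1 = a + 1, b1 = b + 1 & c1 = c + 1] \/
  [/\ a1 = a, b1 = b, c1 = c & weave_levels a b c].
Proof.
have n1 (x : 'Z_m) : x + 1 <> x by exact: (@Zp_add_neq 1).
have n2 (x : 'Z_m) : x + 1 + 1 <> x by rewrite -addrA; exact: (@Zp_add_neq 2).
have n3 (x : 'Z_m) : x + 1 + 1 + 1 <> x.
  by rewrite -!addrA; exact: (@Zp_add_neq 3).
move=> [] [? ?] [] [? ?] [] [? ?]; cyclic_cases n1 n2 n3;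
  by move=> [] [? ?] [] [? ?] [] [? ?]; cyclic_cases n1 n2 n3.
Qed.

Lemma weave_levels_neq (a : 'Z_m) : ~ weave_levels a a a.
Proof. by case=> -[_] /esym; exact: (@Zp_add_neq 1). Qed.

Variables (S : Type) (L : set (set S)) (F : S * 'Z_m -> S * 'Z_m).
Hypothesis psts_L : psts L.
Hypothesis F_triple : forall p q r,
  triple (@weave m S L) p q r -> triple (@weave m S L) (F p) (F q) (F r).
Local Notation T := (triple L).

Lemma F_weave a b c j : T a b c ->
  T (F (a, j)).1 (F (b, j)).1 (F (c, j + 1)).1 /\
  weave_levels (F (a, j)).2 (F (b, j)).2 (F (c, j + 1)).2.
Proof.
move=> Tabc; apply/(weave_tripleP psts_L)/F_triple/(weave_tripleP psts_L).
by split=> //; apply: Or31.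
Qed.

(** The alternative met at level 0 persists: rising keeps the three levels equal, whereas a
    stationary triple never has three equal levels. *)
Lemma line_levels a b c : T a b c ->
  (exists s, forall x j, [set a; b; c] x -> (F (x, j)).2 = s + j) \/
  (forall x j, [set a; b; c] x -> (F (x, j)).2 = (F (x, 0)).2).
Proof.
move=> Tabc; have Tbca := triple_rot Tabc; have Tcab := triple_rot Tbca.
have step j := levels_step
  (F_weave j Tabc).2 (F_weave j Tbca).2 (F_weave j Tcab).2
  (F_weave (j + 1) Tabc).2 (F_weave (j + 1) Tbca).2 (F_weave (j + 1) Tcab).2.
case: (step 0) => [[e1 e2 _ _ _]|[_ _ _ w]].
  left; exists (F (a, 0)).2 => x j; rewrite -(natr_Zp j).
  have [] : [/\ (F (a, j%:R)).2 = (F (a, 0)).2 + j%:R,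
      (F (b, j%:R)).2 = (F (a, 0)).2 + j%:R &
      (F (c, j%:R)).2 = (F (a, 0)).2 + j%:R].
    elim: (j : nat) => [|n [IHa IHb IHc]]; first by rewrite !addr0 -e2 -e1.
    rewrite -natr1; case: (step n%:R) => [[_ _ -> -> ->]|[_ _ _]].
      by rewrite IHa IHb IHc -addrA.
    by rewrite IHa IHb IHc => /weave_levels_neq.
  by move=> ? ? ? [[]|] ->.
right=> x j; rewrite -(natr_Zp j).
have [] : [/\ (F (a, j%:R)).2 = (F (a, 0)).2, (F (b, j%:R)).2 = (F (b, 0)).2 &
    (F (c, j%:R)).2 = (F (c, 0)).2].
  elim: (j : nat) => [|n [IHa IHb IHc]]; first by [].
  rewrite -natr1; case: (step n%:R) => [[]|[-> -> -> _]] //.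
  by rewrite IHa IHb IHc => e1 e2; move: w; rewrite e1 e2 => /weave_levels_neq.
by move=> ? ? ? [[]|] ->.
Qed.

Hypothesis connL : config_connected L.
Hypothesis on_triple : forall x, exists y z, T x y z.

(** Lines through a common point share the alternative, as that point cannot both rise and stay;
    they also share [s], read off at level 0. *)
Lemma weave_levels_dichotomy (x0 : S) :
  (exists s, forall x j, (F (x, j)).2 = s + j) \/
  (forall x j, (F (x, j)).2 = (F (x, 0)).2).
Proof.
have n1 (x : 'Z_m) : x + 1 <> x by exact: (@Zp_add_neq 1).
have [y [z Txyz]] := on_triple x0.
case: (line_levels Txyz) => [[s rise]|const].
  left; exists s => x.
  have ind := @connected_triple_ind _ _ psts_L
    (fun x => forall j, (F (x, j)).2 = s + j) connL.
  apply: (ind _ x0) => [a b c Tabc rise_a j|j]; last by apply: rise; left; left.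
  case: (line_levels Tabc) => [[s' rise']|const].
    have := rise' a 0 (or_introl (or_introl erefl)).
    by rewrite rise_a => /addIr ->; apply: rise'; left; right.
  have := const a 1 (or_introl (or_introl erefl)).
  by rewrite !rise_a addr0 => e; case: (n1 s).
right=> x.
have ind := @connected_triple_ind _ _ psts_L
  (fun x => forall j, (F (x, j)).2 = (F (x, 0)).2) connL.
apply: (ind _ x0) => [a b c Tabc const_a j|j]; last by apply: const; left; left.
case: (line_levels Tabc) => [[s rise]|const'].
  have [e0 e1] := (rise a 0 (or_introl (or_introl erefl)),
    rise a 1 (or_introl (or_introl erefl))).
  by case: (n1 s); rewrite -e1 const_a e0 addr0.
by apply: const'; left; right.
Qed.

End Levels.

(** * Automorphisms of the weaving as products *)

Section WeaveAutomorphisms.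
Local Open Scope ring_scope.

Lemma config_aut_triple (S : Type) (L : set (set S)) f a b c :
  config_aut L f -> triple L a b c -> triple L (f a) (f b) (f c).
Proof. by case=> _ fL; rewrite /triple -image_set3 => /fL. Qed.

Lemma triple_config_aut (S : Type) (L : set (set S)) f g :
  (forall l, L l -> exists a b c, l = [set a; b; c]) ->
  cancel f g -> cancel g f ->
  (forall a b c, triple L a b c -> triple L (f a) (f b) (f c)) ->
  (forall a b c, triple L a b c -> triple L (g a) (g b) (g c)) ->
  config_aut L f.
Proof.
move=> L3 fK gK fT gT; split=> [|l]; first by exists g.
split=> Ll; have [a [b [c e]]] := L3 _ Ll; rewrite e in Ll.
  have -> : l = [set g a; g b; g c].
    rewrite -image_set3 -e image_comp (_ : g \o f = id) ?image_id //.
    by apply/funext => x /=; rewrite fK.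
  exact: gT.
by rewrite e image_set3; exact: fT.
Qed.

Lemma config_aut_inv (S : Type) (L : set (set S)) f g :
  cancel f g -> cancel g f -> config_aut L f -> config_aut L g.
Proof.
move=> fK gK [_ fL]; split=> [|l]; first by exists f.
rewrite -fL image_comp (_ : f \o g = id) ?image_id //.
by apply/funext => x /=; rewrite gK.
Qed.

Variables (m : nat) (S : Type) (L : set (set S)).
Hypothesis psts_L : psts L.
Local Notation T := (triple L).
Local Notation W := (@weave m S L).

Lemma prod_tau_aut f u : config_aut L f -> config_aut W (prod_tau f u).
Proof.
move=> af; have [g fK gK] := af.1; have ag := config_aut_inv fK gK af.
(* Stated for arbitrary [h] and [v], since it serves both the map and its inverse
   [prod_tau g (- u)]. *)
have shift h v : config_aut L h -> forall p q r, triple W p q r ->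
    triple W (@prod_tau m S h v p) (@prod_tau m S h v q) (@prod_tau m S h v r).
  move=> ah p q r /(weave_tripleP psts_L)[Tpqr lev].
  apply/(weave_tripleP psts_L); split; first exact: config_aut_triple.
  by case: lev => -[e1 e2]; rewrite /= e2 e1 addrAC;
    [apply: Or31|apply: Or32|apply: Or33].
apply: (@triple_config_aut _ _ _ (prod_tau g (- u))); [| | |exact: shift..].
- by move=> l [a [b [c [i [_ ->]]]]]; exists (a, i), (b, i), (c, i + 1).
- by case=> a i; rewrite /prod_tau /= fK addrK.
- by case=> a i; rewrite /prod_tau /= gK subrK.
Qed.

Hypothesis connL : config_connected L.
Hypothesis on_triple : forall x, exists y z, T x y z.
Hypothesis m_gt3 : (3 < m)%N.
Hypothesis no_pappus : forall k, (2 < k)%N -> (k %| m)%N ->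
  ~ contains_config L (@polypappus k 1%g).

Lemma weave_aut_rising (x0 : S) F G :
  cancel F G -> cancel G F -> config_aut W F -> config_aut W G ->
  exists s, forall x j, (F (x, j)).2 = s + j.
Proof.
move=> FK GK aF aG; have m_gt1 : (1 < m)%N by apply: ltn_trans m_gt3.
have FT p q r := @config_aut_triple _ _ F p q r aF.
have GT p q r := @config_aut_triple _ _ G p q r aG.
have [//|constF] := weave_levels_dichotomy m_gt3 psts_L FT connL on_triple x0.
have [[s riseG]|constG] :=
  weave_levels_dichotomy m_gt3 psts_L GT connL on_triple x0.
  (* If [G] shifts levels while [F] forgets [j], then [G] after [F] would return the same level for
     every [j]. *)
  have lev j : s + (F (x0, 0)).2 = j.
    by rewrite -(constF x0 j) -(riseG (F (x0, j)).1) -surjective_pairing FK.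
  have := @Zp_add_neq m m_gt3 1 0 isT; case; rewrite add0r.
  by rewrite -[LHS](lev 1) [LHS](lev 0).
have [y [z Txyz]] := on_triple x0.
(* The level of a [G]-image depends only on the first coordinate, so the argument's level may be
   reset to 0; thus [(F (x, j)).1] determines [j]. *)
have FG x j : (G ((F (x, j)).1, 0)).2 = j.
  by rewrite -(constG _ (F (x, j)).2) -surjective_pairing FK.
case: (no_pappus (ltnW m_gt3) (dvdnn m)).
apply: (contains_polypappus (u := fun j x => (F (x, j)).1) psts_L Txyz).
  by move=> i a b c Tabc; have [] := F_weave psts_L FT i Tabc.
move=> i j a b Ta Tb e; have eij : i = j by rewrite -(FG a i) e FG.
split=> //; move: e; rewrite eij.
have Tyzx := triple_rot Txyz; have Tzxy := triple_rot Tyzx.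
have neq u v w : T u v w -> (F (u, j)).1 <> (F (v, j)).1.
  by move=> Tuvw; exact: (triple_neq psts_L (F_weave psts_L FT j Tuvw).1).
by move: Ta Tb => [[]|] -> [[]|] -> // e; exfalso; move: e;
  first [apply: neq; eassumption | apply/nesym/neq; eassumption].
Qed.

Lemma weave_autP (x0 : S) F :
  config_aut W F -> exists f u, config_aut L f /\ F = prod_tau f u.
Proof.
move=> aF; have [G FK GK] := aF.1; have aG := config_aut_inv FK GK aF.
have m_gt1 : (1 < m)%N by apply: ltn_trans m_gt3.
have [s rise] := weave_aut_rising x0 FK GK aF aG.
have FT p q r := @config_aut_triple _ _ F p q r aF.
have GT p q r := @config_aut_triple _ _ G p q r aG.
pose f j x := (F (x, j)).1; pose g j x := (G (x, s + j)).1.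
have FE x j : F (x, j) = (f j x, s + j) by rewrite [LHS]surjective_pairing rise.
have fK j : cancel (f j) (g j) by move=> x; rewrite /g -FE FK.
have GE x j : G (x, s + j) = (g j x, j).
  (* The level of [G (x, s + j)] is found by applying [F] to it and cancelling [s]. *)
  have := GK (x, s + j); rewrite [G _]surjective_pairing FE.
  move=> /(congr1 snd) /= /addrI e.
  by rewrite [X in (_, X) = _]e.
have gK j : cancel (g j) (f j) by move=> x; rewrite /f -GE GK.
have fT j a b c : T a b c -> T (f j a) (f j b) (f (j + 1) c).
  by case/(F_weave psts_L FT j).
have gT j a b c : T a b c -> T (g j a) (g j b) (g (j + 1) c).
  by case/(F_weave psts_L GT (s + j)); rewrite /g addrA.
have f0 :=
  rising_constant psts_L connL on_triple m_gt1 fT gT fK gK x0 no_pappus.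
have g0 j : g j = g 0.
  by apply/funext => x; rewrite -{1}(gK 0 x) -(f0 j) fK.
exists (f 0), s; split.
  apply: (triple_config_aut (g := g 0)) => //.
  - by move=> l /(line_triple psts_L)[a [b [c [-> _]]]]; exists a, b, c.
  (* Constancy turns the raised [f 1] into [f 0], so all three points of a line are moved by one
     map. *)
  - by move=> a b c /(fT 0); rewrite add0r (f0 1).
  - by move=> a b c /(gT 0); rewrite add0r (g0 1).
by apply/funext => -[x j]; rewrite FE f0 addrC.
Qed.

End WeaveAutomorphisms.

Theorem theorem3p6 (m : nat) (S : Type) (L : set (set S)) :
  (3 < m)%N ->
  [set: S] !=set0 ->
  psts L ->
  config_connected L ->
  (forall x : S, degree_gt1 L x) ->
  anti_polypappian m L ->
  config_aut (@weave m S L) =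
    [set prod_tau f u | f in config_aut L & u in [set: 'Z_m]]
  /\ isomorphic_groups (autGroup (@weave m S L)) (autGroup L * 'Z_m)%type.
Proof.
move=> m_gt3 [x0 _] psts_L connL deg anti.
have on_triple x := point_triple psts_L (deg x).
have no_pappus k (k_gt2 : (2 < k)%N) := let: And3 h _ _ := anti k k_gt2 in h.
have autP := weave_autP psts_L connL on_triple m_gt3 no_pappus x0.
split.
  apply/seteqP; split=> [F /autP[f [u [af ->]]]|_ [f af [u _ <-]]].
    by exists f => //; exists u.
  exact: prod_tau_aut.
pose psi (p : autGroup L * 'Z_m) : autGroup (@weave m S L) :=
  AutGroup (prod_tau_aut psts_L p.2 (autGroupP p.1)).
have psi_onto F : exists p, psi p = F.
  have [f [u [af e]]] := autP _ (autGroupP F).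
  by exists (AutGroup af, u); apply: autGroup_ext => x; rewrite e.
have psi_inj : injective psi.
  move=> [f u] [f' u'] /(congr1 (@autGroup_fun _ _)) /= e.
  have e1 x i := congr1 (fun h => h (x, i)) e.
  congr pair; first by apply: autGroup_ext => x; case: (e1 x 0%R).
  (* The translation part is read off over the point [x0], hence the nonemptiness assumption. *)
  by have /(congr1 snd) /= /addrI := e1 x0 0%R.
have [phi phiK] := choice psi_onto.
have psiK p : phi (psi p) = p by apply: psi_inj; rewrite phiK.
have psiM p q : psi (p * q)%g = (psi p * psi q)%g.
  apply: autGroup_ext => -[x i] /=; rewrite /prod_tau /=; congr pair.
  by rewrite -addrA (addrC q.2).
have phiM : {morph phi : F G / (F * G)%g}.
  by move=> F G; apply: psi_inj; rewrite psiM !phiK.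
pose M := isMultiplicative.Build _ _ phi phiM.
exists (HB.pack phi M : {multiplicative _ -> _}).
by exists psi.
Qed.
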